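(* For every integer $n\geq2$, the HOMFLY polynomial of the torus link $T(2,n)$ is $$P(T(2,n);y,z)=H_{n-1}(y^{-1}z,y^{-2})-(y^{-1}+y^{-3})z^{-1}H_{n-2}(y^{-1}z,y^{-2}),$$ where, for $k\ge0$, $$H_k(e_1,e_2)=\sum_{j=0}^{\lfloor k/2\rfloor}(-1)^j\binom{k-j}{j}e_1^{k-2j}e_2^j.$$
   Context: A crossing of an oriented link diagram in the oriented plane is positive if the ordered pair (tangent vector of the overpassing arc, tangent vector of the underpassing arc) agrees with the orientation of the plane, and negative otherwise. $B_2$ denotes the braid group on $2$ strands with generator $\sigma_1$, the elementary braid in which the two strands form a positive crossing (both strands oriented in the same direction along the braid). $\overline{x}$ denotes the closure of a braid $x$, an oriented link, and $T(2,n)=\overline{\sigma_1^n}$ for $n\in\mathbb{Z}$. The HOMFLY polynomial $P(L;y,z)\in\mathbb{Z}[y^{\pm1},z^{\pm1}]$ of an oriented link $L$ is the unique oriented link invariant, computed from any diagram, with $P(\text{unknot};y,z)=1$ and $yP(D_+;y,z)+y^{-1}P(D_-;y,z)=zP(D_0;y,z)$ for every skein triple $(D_+,D_-,D_0)$, i.e. three oriented diagrams identical except near one crossing, where the crossing is respectively positive, negative, and smoothed (orientation-consistently). The polynomial $H_k$ is characterized by $H_k(\lambda_1+\lambda_2,\lambda_1\lambda_2)=\sum_{r=0}^k\lambda_1^{k-r}\lambda_2^r$. *)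

(* Defs.v *)
From Stdlib Require Import Relation_Operators.
From mathcomp Require Import all_boot all_order all_algebra.
From mathcomp Require Import mpoly.

Set Implicit Arguments.
Unset Strict Implicit.
Unset Printing Implicit Defensive.

Import Order.TTheory GRing.Theory Num.Theory.

Local Open Scope ring_scope.

(* A plane diagram in general position with respect to the height function is
  cut by horizontal lines into slices, each with a single local minimum, local
  maximum or crossing.  It is encoded by its slices, read from bottom to top.
  A slice [(i, e)] is the event [e] with [i] vertical strands to its left.
  The strands met by a horizontal line are recorded from left to right by
  their orientations: [true] is upward, [false] is downward. *)

Variant event :=
  | Cup of bool    (* local minimum; the flag orients its left leg *)
  | Cap            (* local maximum *)
  | Cross of bool. (* crossing; the flag is [true] when the overpassing arc is
                      the one joining bottom left to top right *)

Definition slice : Type := nat * event.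

(* Numbers of strand ends at the bottom and at the top of an event. *)
Definition ends_below (e : event) : nat := if e is Cup _ then 0 else 2.
Definition ends_above (e : event) : nat := if e is Cap then 0 else 2.

Definition event_step (e : event) (s : seq bool) : option (seq bool) :=
  match e, s with
  | Cup d, _ => Some [:: d, ~~ d & s]
  | Cap, a :: b :: s' => if a != b then Some s' else None
  | Cross _, a :: b :: s' => Some [:: b, a & s']
  | _, _ => None
  end.

Definition slice_step (s : seq bool) (x : slice) : option (seq bool) :=
  if (x.1 <= size s)%N then
    omap (cat (take x.1 s)) (event_step x.2 (drop x.1 s))
  else None.

(* Orientations above the slices [w], given the orientations [s] below them;
   [None] when the slices do not fit together as oriented arcs. *)
Fixpoint run (s : seq bool) (w : seq slice) : option (seq bool) :=
  if w is x :: w' then obind (run^~ w') (slice_step s x) else Some s.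

(* The empty diagram is excluded: links are nonempty, and the skein relation
   would not determine the polynomial of the empty link. *)
Definition is_diagram (w : seq slice) : bool :=
  ~~ nilp w && (run [::] w == Some [::]).

Definition diagram : Type := {w : seq slice | is_diagram w}.

(* Planar isotopies and Reidemeister moves of sliced diagrams (Freyd-Yetter,
   Turaev).  Moves in other positions, e.g. a Reidemeister move turned sideways
   or a curl on a vertical strand, are compositions of these.  Each move keeps
   the orientations at its boundary. *)

Inductive local_move : seq slice -> seq slice -> Prop :=
  (* Planar isotopy: exchanging the heights of two events separated by [k]
     strands. *)
  | Exchange i k e f :
      local_move [:: (i, e); ((i + ends_above e + k)%N, f)]
                 [:: ((i + ends_below e + k)%N, f); (i, e)]
  (* Planar isotopy: cancelling a local minimum and a local maximum. *)
  | ZigzagL i d : local_move [:: (i.+1, Cup d); (i, Cap)] [::]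
  | ZigzagR i d : local_move [:: (i, Cup d); (i.+1, Cap)] [::]
  (* Planar isotopy: moving a crossing through a local extremum of one of its
     arcs.  The flag changes because this arc goes from rising to the left to
     rising to the right, or conversely. *)
  | SlideCup i d o :
      local_move [:: (i, Cup d); (i.+1, Cross o)]
                 [:: (i.+1, Cup d); (i, Cross (~~ o))]
  | SlideCap i o :
      local_move [:: (i.+1, Cross o); (i, Cap)]
                 [:: (i, Cross (~~ o)); (i.+1, Cap)]
  | Reidemeister1Cup i d o :
      local_move [:: (i, Cup d); (i, Cross o)] [:: (i, Cup (~~ d))]
  | Reidemeister1Cap i o :
      local_move [:: (i, Cross o); (i, Cap)] [:: (i, Cap)]
  | Reidemeister2 i o :
      local_move [:: (i, Cross o); (i, Cross (~~ o))] [::]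
  (* Number the three strands from left to right at the bottom: [a], [b], [c]
     tell whether 1 passes over 2, 1 over 3 and 2 over 3.  The hypothesis says
     that "over" is transitive, i.e. the three strands lie at three levels. *)
  | Reidemeister3 i (a b c : bool) :
      (a = c -> b = a) ->
      local_move [:: (i, Cross a); (i.+1, Cross b); (i, Cross c)]
                 [:: (i.+1, Cross c); (i, Cross b); (i.+1, Cross a)].

Definition move (D D' : diagram) : Prop :=
  exists u v l r : seq slice,
    [/\ local_move l r, sval D = u ++ l ++ v & sval D' = u ++ r ++ v].

(* Two diagrams represent the same oriented link. *)
Definition isotopic : diagram -> diagram -> Prop := clos_refl_sym_trans _ move.

Definition det2 (p q : int * int) : int := p.1 * q.2 - p.2 * q.1.

(* Tangent vectors of the arc joining bottom left to top right, and of the arc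
   joining bottom right to top left, according to their orientation. *)
Definition tangent_rising (up : bool) : int * int :=
  if up then (1, 1) else (-1, -1).
Definition tangent_falling (up : bool) : int * int :=
  if up then (-1, 1) else (1, -1).

(* Sign of [Cross o] when the bottom left and bottom right strand ends are
   oriented by [a] and [b]: the pair (overpassing tangent, underpassing
   tangent) is compared with the orientation of the plane. *)
Definition positive_crossing (a b o : bool) : bool :=
  if o then 0 < det2 (tangent_rising a) (tangent_falling b)
  else 0 < det2 (tangent_falling b) (tangent_rising a).

(* Smoothing compatible with the orientations: two vertical arcs if the strands
   are both upward or both downward, a maximum below a minimum otherwise. *)
Definition smoothing (i : nat) (a b : bool) : seq slice :=
  if a == b then [::] else [:: (i, Cap); (i, Cup b)].

Definition skein_triple (Dpos Dneg Dzero : diagram) : Prop :=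
  exists (u v : seq slice) (s t : seq bool) (a b o : bool),
    let i := size s in
    [/\ run [::] u = Some (s ++ [:: a, b & t]),
        positive_crossing a b o,
        sval Dpos = u ++ (i, Cross o) :: v,
        sval Dneg = u ++ (i, Cross (~~ o)) :: v &
        sval Dzero = u ++ smoothing i a b ++ v].

(* Z[y^-1, y, z^-1, z] is seen inside the field of fractions of Z[y, z]. *)
Local Notation tofrac := (@FracField.tofrac _).

Definition Qyz : fieldType := {fraction {mpoly int[2]}}.

Definition y : Qyz := tofrac ('X_(0 : 'I_2) : {mpoly int[2]}).
Definition z : Qyz := tofrac ('X_(1 : 'I_2) : {mpoly int[2]}).

Definition is_laurent (f : Qyz) : Prop :=
  exists (p : {mpoly int[2]}) (m n : nat), f = tofrac p / (y ^+ m * z ^+ n).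

Definition unknot : diagram := exist is_diagram [:: (0%N, Cup true); (0%N, Cap)] isT.

(* These properties determine [P] up to equality on all diagrams, so "the HOMFLY
   polynomial" is any [P] satisfying them. *)
Record is_HOMFLY (P : diagram -> Qyz) : Prop := {
  HOMFLY_laurent : forall D, is_laurent (P D);
  HOMFLY_invariant : forall D D', isotopic D D' -> P D = P D';
  HOMFLY_unknot : P unknot = 1;
  HOMFLY_skein : forall Dpos Dneg Dzero, skein_triple Dpos Dneg Dzero ->
    y * P Dpos + y^-1 * P Dneg = z * P Dzero }.

(* Words in the generator of B_2 and its inverse: [true] stands for sigma_1. *)
Definition braid2 : Type := seq bool.

Definition sigma1_pow (n : int) : braid2 :=
  match n with Posz k => nseq k true | Negz k => nseq k.+1 false end.

(* The braid is drawn upward on the two strands to the left, which are closed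
   by two nested arcs to the right. *)
Definition closure_word (x : braid2) : seq slice :=
  [:: (0%N, Cup true); (1%N, Cup true)] ++ [seq (0%N, Cross o) | o <- x]
    ++ [:: (1%N, Cap); (0%N, Cap)].

Lemma closure_word_is_diagram (x : braid2) : is_diagram (closure_word x).
Proof. by rewrite /is_diagram /=; elim: x. Qed.

Definition braid_closure (x : braid2) : diagram :=
  exist is_diagram (closure_word x) (closure_word_is_diagram x).

Definition T2 (n : int) : diagram := braid_closure (sigma1_pow n).

Definition H (K : comNzRingType) (k : nat) (e1 e2 : K) : K :=
  \sum_(0 <= j < (k./2).+1)
    (-1) ^+ j * 'C(k - j, j)%:R * e1 ^+ (k - j.*2) * e2 ^+ j.

(* Main.v *)
Require Import Defs.
From Stdlib Require Import Relation_Operators.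
From mathcomp Require Import all_boot all_order all_algebra.
From mathcomp Require Import mpoly.
From mathcomp Require Import zify ring.

Import Order.TTheory GRing.Theory Num.Theory.
Local Open Scope ring_scope.

(** Switching or smoothing one crossing of the standard diagram of [T(2, n+2)]
    gives a skein triple whose other members are [T(2, n)], after a
    Reidemeister 2 move, and [T(2, n+1)].  So [u n = P (T(2, n))] satisfies
    [u (n+2) = e1 * u (n+1) - e2 * u n] with [e1 = y^-1 z] and [e2 = y^-2].
    Pascal's rule shows that [H k e1 e2] is the fundamental solution of this
    recurrence (it is the complete symmetric polynomial in the two roots of
    [X^2 - e1 X + e2]), hence [u (n+2) = u 1 * H (n+1) - e2 * u 0 * H n].

    The initial values come from closing the one-letter braids of both signs:
    each closure is an unknot with a curl, so [u 1 = 1], and their skein triple,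
    whose smoothing is the two-component unlink [T(2, 0)], reads
    [y + y^-1 = z * u 0]. *)

(** The summands beyond [k./2] vanish, so that the sums for several values of
    [k] can be compared over a common range. *)
Lemma H_widen (K : comNzRingType) (k N : nat) (e1 e2 : K) : (k./2 < N)%N ->
  H k e1 e2 = \sum_(0 <= j < N)
    (-1) ^+ j * 'C(k - j, j)%:R * e1 ^+ (k - j.*2) * e2 ^+ j.
Proof.
move=> ltkN; rewrite /H [RHS](big_cat_nat (n := k./2.+1)) //=.
rewrite [X in _ + X]big_nat_cond [X in _ + X]big1 ?addr0 // => j.
rewrite andbT => /andP[ltkj _].
by rewrite bin_small ?mulr0 ?mul0r //; lia.
Qed.

(** Pascal's rule, applied to the coefficient of [e2 ^+ j.+1]. *)
Lemma H_rec (K : comNzRingType) (k : nat) (e1 e2 : K) :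
  H k.+2 e1 e2 = e1 * H k.+1 e1 e2 - e2 * H k e1 e2.
Proof.
rewrite (@H_widen _ k.+2 k.+2); last by lia.
rewrite (@H_widen _ k.+1 k.+2); last by lia.
rewrite (@H_widen _ k k.+1); last by lia.
rewrite !(big_nat_recl k.+1) //= mulrDr -addrA; congr (_ + _).
  by rewrite double0 !subn0 !bin0 exprS; ring.
rewrite !mulr_sumr -sumrB; apply: eq_big_nat => j /andP[_ lejk].
have -> : (k.+2 - j.+1 = (k - j).+1)%N by lia.
have -> : (k.+2 - j.+1.*2 = k - j.*2)%N by lia.
rewrite subSS binS natrD !exprS.
have [ltkj|lejk2] := ltnP k (j.*2.+1).
  (* The power of [e1] on the right is truncated; its coefficient is zero. *)
  by rewrite (bin_small (m := j.+1)) //; [ring | lia].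
have -> : (k - j.*2 = (k.+1 - j.+1.*2).+1)%N by lia.
by rewrite exprS; ring.
Qed.

Lemma recurrence_solution (K : comNzRingType) (e1 e2 : K) (u : nat -> K) :
  (forall n, u n.+2 = e1 * u n.+1 - e2 * u n) ->
  forall n, u n.+2 = u 1 * H n.+1 e1 e2 - e2 * u 0 * H n e1 e2.
Proof.
move=> u_rec.
have H0 : H 0 e1 e2 = 1.
  by rewrite /H big_nat1 bin0 !expr0 !mulr1.
have H1 : H 1 e1 e2 = e1.
  by rewrite /H big_nat1 bin0 !expr0 !mulr1 mul1r expr1.
suff both n : u n.+2 = u 1 * H n.+1 e1 e2 - e2 * u 0 * H n e1 e2 /\
    u n.+3 = u 1 * H n.+2 e1 e2 - e2 * u 0 * H n.+1 e1 e2.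
  by move=> n; case: (both n).
elim: n => [|n [IH IH1]].
  by rewrite !u_rec H_rec H0 H1; split; ring.
by split=> //; rewrite u_rec IH1 IH !H_rec; ring.
Qed.

Lemma y_neq0 : y != 0.
Proof. by rewrite /y tofrac_eq0 -msupp_eq0 msuppX. Qed.

Lemma z_neq0 : z != 0.
Proof. by rewrite /z tofrac_eq0 -msupp_eq0 msuppX. Qed.

Lemma move_isotopic (D D' : diagram) (u v l r : seq slice) :
  local_move l r -> sval D = u ++ l ++ v -> sval D' = u ++ r ++ v ->
  isotopic D D'.
Proof. by move=> lr eD eD'; apply: rst_step; exists u, v, l, r. Qed.

(** The crossing slides through the inner minimum, from its left leg to its
    right leg, and becomes a curl on the inner maximum; once the curl is
    removed, a zigzag remains. *)
Lemma braid_closure1_isotopic (o : bool) :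
  isotopic (braid_closure [:: o]) unknot.
Proof.
pose slid : diagram := exist is_diagram
  [:: (0, Cup true); (0, Cup true); (1, Cross (~~ o)); (1, Cap); (0, Cap)]%N
  isT.
pose uncurled : diagram := exist is_diagram
  [:: (0, Cup true); (0, Cup true); (1, Cap); (0, Cap)]%N isT.
apply: (rst_trans _ _ _ slid).
  apply: rst_sym.
  apply: (@move_isotopic _ _ [:: (0, Cup true)]%N [:: (1, Cap); (0, Cap)]%N).
  - exact: (SlideCup 0 true (~~ o)).
  - by [].
  - by rewrite /= negbK.
apply: (rst_trans _ _ _ uncurled).
  apply: (@move_isotopic _ _ [:: (0, Cup true); (0, Cup true)]%N
                             [:: (0, Cap)]%N).
  - exact: (Reidemeister1Cap 1 (~~ o)).
  - by [].
  - by [].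
apply: (@move_isotopic _ _ [:: (0, Cup true)]%N [:: (0, Cap)]%N).
- exact: (ZigzagR 0 true).
- by [].
- by [].
Qed.

Lemma braid_closure_cancel (o : bool) (x : braid2) :
  isotopic (braid_closure [:: o, ~~ o & x]) (braid_closure x).
Proof.
apply: (@move_isotopic _ _ [:: (0, Cup true); (1, Cup true)]%N
          ([seq (0%N, Cross o') | o' <- x] ++ [:: (1, Cap); (0, Cap)]%N)).
- exact: (Reidemeister2 0 o).
- by [].
- by [].
Qed.

Lemma braid_closure_skein (x : braid2) :
  skein_triple (braid_closure (true :: x)) (braid_closure (false :: x))
    (braid_closure x).
Proof.
exists [:: (0, Cup true); (1, Cup true)]%N.
exists ([seq (0%N, Cross o) | o <- x] ++ [:: (1, Cap); (0, Cap)]%N).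
by exists [::], [:: false; false], true, true, true.
Qed.

Lemma HOMFLY_braid_closure1 (P : diagram -> Qyz) (P_HOMFLY : is_HOMFLY P)
    (o : bool) :
  P (braid_closure [:: o]) = 1.
Proof.
rewrite (HOMFLY_invariant P_HOMFLY (braid_closure1_isotopic o)).
exact: HOMFLY_unknot.
Qed.

Lemma HOMFLY_T2_0 (P : diagram -> Qyz) (P_HOMFLY : is_HOMFLY P) :
  P (T2 0) = (y + y^-1) / z.
Proof.
have := HOMFLY_skein P_HOMFLY (braid_closure_skein [::]).
rewrite !HOMFLY_braid_closure1 // !mulr1 => ->.
by rewrite mulrC mulKf ?z_neq0.
Qed.

Lemma HOMFLY_T2_rec (P : diagram -> Qyz) (P_HOMFLY : is_HOMFLY P) (n : nat) :
  P (T2 n.+2%:Z) = y^-1 * z * P (T2 n.+1%:Z) - y ^- 2 * P (T2 n%:Z).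
Proof.
have := HOMFLY_skein P_HOMFLY (braid_closure_skein (nseq n.+1 true)).
rewrite (HOMFLY_invariant P_HOMFLY
           (braid_closure_cancel false (nseq n true))).
move=> /(canRL (addrK _)) /(canRL (mulKf y_neq0)) ->.
by rewrite mulrBr !mulrA expr2 invfM.
Qed.

Theorem theorem17 (P : diagram -> Qyz) (P_HOMFLY : is_HOMFLY P) (n : nat)
    (n_ge2 : (2 <= n)%N) :
  P (T2 n%:Z) =
    H n.-1 (y^-1 * z) (y ^- 2)
      - (y^-1 + y ^- 3) * z^-1 * H n.-2 (y^-1 * z) (y ^- 2).
Proof.
case: n n_ge2 => [|[|n]] // _.
rewrite (@recurrence_solution _ _ _ (fun m : nat => P (T2 m%:Z))
           (HOMFLY_T2_rec P P_HOMFLY)).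
rewrite (HOMFLY_braid_closure1 P P_HOMFLY true) HOMFLY_T2_0 // mul1r.
congr (_ - _ * _); rewrite mulrA mulrDr; congr (_ * _); congr (_ + _).
  by rewrite expr2 invfM mulfVK ?y_neq0.
by rewrite -invfM -exprSr.
Qed.
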